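(* Let $R$ be a $G$-graded commutative ring, $M$ and $T$ be $G$-graded $R$-modules, $s\in h^*(R)$, and let $f:M\rightarrow T$ be a graded $R$-homomorphism. (1) If $K\in GSpec_s({}_RT)$ and $s\notin(f^{-1}(K):_RM)$, then $f^{-1}(K)\in GSpec_s({}_RM)$. (2) If $f$ is a graded $R$-epimorphism and $N\in GSpec_s({}_RM)$ with $\mathrm{Ker}(f)\subseteq N$, then $f(N)\in GSpec_s({}_RT)$.
   Context: $G$ is a group with identity $e$; rings are commutative with nonzero unity $1$ and modules are unital. A ring $R$ is $G$-graded if $R=\bigoplus_{g\in G}R_g$ with additive subgroups $R_g$ satisfying $R_gR_h\subseteq R_{gh}$; $h(R)=\bigcup_{g\in G}R_g$ and $h^*(R)=h(R)\setminus\{0\}$. An $R$-module $M$ is $G$-graded if $M=\bigoplus_{g\in G}M_g$ with additive subgroups $M_g$ satisfying $R_gM_h\subseteq M_{gh}$; $h(M)=\bigcup_{g\in G}M_g$. A submodule $N$ of $M$ is graded if $N=\bigoplus_{g\in G}(N\cap M_g)$. A graded $R$-homomorphism $f:M\to T$ is an $R$-homomorphism with $f(M_g)\subseteq T_g$ for all $g\in G$; a graded $R$-epimorphism is a surjective one. Write $(N:_RM)=\{r\in R: rM\subseteq N\}$. For $s\in h^*(R)$, a graded $R$-submodule $N$ of $M$ is graded $s$-prime if $s\notin(N:_RM)$ and, for all $r\in h(R)$ and $m\in h(M)$, $rm\in N$ implies $sr\in(N:_RM)$ or $sm\in N$. $GSpec_s({}_RM)$ is the set of graded $s$-prime $R$-submodules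 of $M$. *)

(* Defs.v *)
From mathcomp Require Import all_boot all_order all_algebra.
From mathcomp Require Import boolp classical_sets functions cardinality fsbigop.

Set Implicit Arguments.
Unset Strict Implicit.
Unset Printing Implicit Defensive.

Local Open Scope classical_set_scope.
Local Open Scope ring_scope.

(* [c] is a decomposition of [x] along the family [A].  Finiteness of the
   support is required explicitly: [\sum_(g \in D) c g] is [0] by convention
   when [c] has infinite support. *)
Definition decomposition (I : choiceType) (V : zmodType) (A : I -> set V)
    (x : V) (c : I -> V) : Prop :=
  [/\ finite_set (c @^-1` [set~ 0]),
      forall g, A g (c g)
    & x = \sum_(g \in [set: I]) c g].

Definition direct_sum (I : choiceType) (V : zmodType) (N : set V)
    (A : I -> set V) : Prop :=
  [/\ forall g, GRing.zmod_closed (mem (A g)),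
      N = [set x | exists c, decomposition A x c]
    & forall x c c', decomposition A x c -> decomposition A x c' -> c = c'].

Definition graded_ring (G : groupType) (R : comNzRingType)
    (Rg : G -> set R) : Prop :=
  direct_sum [set: R] Rg /\
  forall g h r r', Rg g r -> Rg h r' -> Rg (g * h)%g (r * r').

Definition graded_module (G : groupType) (R : comNzRingType)
    (Rg : G -> set R) (M : lmodType R) (Mg : G -> set M) : Prop :=
  direct_sum [set: M] Mg /\
  forall g h r m, Rg g r -> Mg h m -> Mg (g * h)%g (r *: m).

Definition homogeneous (G : groupType) (V : zmodType) (Vg : G -> set V) :
    set V :=
  \bigcup_(g in [set: G]) Vg g.

Definition graded_submodule (G : groupType) (R : comNzRingType)
    (M : lmodType R) (Mg : G -> set M) (N : set M) : Prop :=
  GRing.submod_closed (mem N) /\ direct_sum N (fun g => N `&` Mg g).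

Definition graded_hom (G : groupType) (R : comNzRingType) (M T : lmodType R)
    (Mg : G -> set M) (Tg : G -> set T) (f : {linear M -> T}) : Prop :=
  forall g, f @` Mg g `<=` Tg g.

Definition graded_epi (G : groupType) (R : comNzRingType) (M T : lmodType R)
    (Mg : G -> set M) (Tg : G -> set T) (f : {linear M -> T}) : Prop :=
  graded_hom Mg Tg f /\ range f = [set: T].

Definition ker (R : comNzRingType) (M T : lmodType R) (f : {linear M -> T}) :
    set M :=
  f @^-1` [set 0].

(* The residual (N :_R M). *)
Definition colon (R : comNzRingType) (M : lmodType R) (N : set M) : set R :=
  [set r | forall m, N (r *: m)].

Definition graded_s_prime (G : groupType) (R : comNzRingType)
    (Rg : G -> set R) (M : lmodType R) (Mg : G -> set M) (s : R)
    (N : set M) : Prop :=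
  [/\ graded_submodule Mg N,
      ~ colon N s
    & forall r m, homogeneous Rg r -> homogeneous Mg m ->
        N (r *: m) -> colon N (s * r) \/ N (s *: m)].

Definition GSpec (G : groupType) (R : comNzRingType) (Rg : G -> set R)
    (M : lmodType R) (Mg : G -> set M) (s : R) : set (set M) :=
  [set N | graded_s_prime Rg Mg s N].

(* Main.v *)
(** A submodule of a graded module is graded exactly when it contains the
    homogeneous components of its elements.  A graded homomorphism sends the
    components of [x] to those of [f x], so gradedness passes to preimages and
    images, and a graded epimorphism is onto in each degree: homogeneous
    elements of the target lift to homogeneous elements of the source.  Since
    [f x \in f @` N] forces [x \in N] when [N] contains the kernel, the
    s-prime conditions transfer directly. *)

Require Import Defs.
From mathcomp Require Import all_boot all_order all_algebra.
From mathcomp Require Import boolp classical_sets functions cardinality fsbigop.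

Local Open Scope classical_set_scope.
Local Open Scope ring_scope.

Set Implicit Arguments.
Unset Strict Implicit.
Unset Printing Implicit Defensive.

Import GRing.Theory.

(** Both sides become ordinary finite sums over the support of [c], which contains the support of
    [f \o c] because [f] sends 0 to 0. *)
Lemma raddf_fsbig (I : choiceType) (U V : zmodType) (f : {additive U -> V})
    (c : I -> U) : finite_set (c @^-1` [set~ 0]) ->
  f (\sum_(i \in [set: I]) c i) = \sum_(i \in [set: I]) f (c i).
Proof.
move=> finc; rewrite (fsbigTE (fset_set (c @^-1` [set~ 0]))).
  rewrite raddf_sum (fsbigTE (fset_set (c @^-1` [set~ 0]))) // => i.
  by rewrite in_fset_set // notin_setE /= => /contrapT ->; rewrite raddf0.
by move=> i; rewrite in_fset_set // notin_setE /= => /contrapT.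
Qed.

Lemma decomposition_additive (I : choiceType) (U V : zmodType)
    (A : I -> set U) (B : I -> set V) (f : {additive U -> V})
    (fAB : forall i, f @` A i `<=` B i) (x : U) (c : I -> U) :
  decomposition A x c -> decomposition B (f x) (f \o c).
Proof.
move=> [finc Ac ->]; split.
- by apply: sub_finite_set finc => i /= fci0 ci0; apply: fci0; rewrite ci0 raddf0.
- by move=> i; apply: fAB; exists (c i).
- exact: raddf_fsbig.
Qed.

Lemma decomposition_sub (I : choiceType) (V : zmodType) (A B : I -> set V)
    (AB : forall i, A i `<=` B i) (x : V) (c : I -> V) :
  decomposition A x c -> decomposition B x c.
Proof. by move=> [finc Ac xE]; split=> // i; apply/AB/Ac. Qed.

(** Together with uniqueness, this identifies the components of a homogeneous element. *)
Lemma decomposition_delta (I : choiceType) (V : zmodType) (A : I -> set V)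
    (A0 : forall i, A i 0) (i : I) (x : V) :
  A i x -> decomposition A x (fun j => if j == i then x else 0).
Proof.
move=> Aix; split.
- apply: (sub_finite_set _ (finite_set1 i)) => j /=.
  by case: eqP => // _ /(_ erefl).
- by move=> j; case: eqP => [->|_].
- rewrite -(fsbig_widen [set i]) ?fsbig_set1 ?eqxx // => j [_ /= /eqP].
  by move=> /negbTE ->.
Qed.

Lemma direct_sum0 (I : choiceType) (V : zmodType) (N : set V)
    (A : I -> set V) (i : I) : direct_sum N A -> A i 0.
Proof. by move=> [/(_ i) [A0 _] _ _]; rewrite -in_setE. Qed.

Lemma direct_sum_total (I : choiceType) (V : zmodType) (A : I -> set V) (x : V) :
  direct_sum [set: V] A -> exists c, decomposition A x c.
Proof. by move=> [_ VE _]; have : [set: V] x by []; rewrite VE. Qed.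

(** A decomposition of [x] inside [N] is also one in [V], so uniqueness in [V] forces it to be
    [c]. *)
Lemma direct_sum_component (I : choiceType) (V : zmodType) (N : set V)
    (A : I -> set V) (x : V) (c : I -> V) (i : I) :
  direct_sum [set: V] A -> direct_sum N (fun j => N `&` A j) ->
  N x -> decomposition A x c -> N (c i).
Proof.
move=> [_ _ uniqA] [_ NE _]; rewrite {1}NE => -[d dx] cx.
have dAx : decomposition A x d by apply: decomposition_sub dx => j y [].
by rewrite (uniqA _ _ _ cx dAx); case: dx => _ /(_ i) [].
Qed.

(** Converse to [direct_sum_component]: the components in [V] of an element of [N] already form a
    decomposition inside [N], and uniqueness is inherited from [V]. *)
Lemma direct_sum_setI (I : choiceType) (V : zmodType) (N : set V)
    (A : I -> set V) :
  direct_sum [set: V] A -> GRing.zmod_closed (mem N) ->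
  (forall x c, N x -> decomposition A x c -> forall i, N (c i)) ->
  direct_sum N (fun i => N `&` A i).
Proof.
move=> sumA [N0 NB] Ncomp; have [zA _ uniqA] := sumA.
have NAA i : N `&` A i `<=` A i by move=> x [].
split.
- move=> i; have [A0 AB] := zA i; split; first by rewrite in_setI N0 A0.
  move=> x y; rewrite !in_setI => /andP[Nx Ax] /andP[Ny Ay].
  by apply/andP; split; [apply: NB|apply: AB].
- apply/seteqP; split=> [x Nx|x [c [finc NAc ->]]].
    have [c cx] := direct_sum_total x sumA; exists c.
    by have [finc Ac xE] := cx; split=> // i; split=> //; apply: Ncomp cx i.
  have N0' : N 0 by rewrite -in_setE.
  have NBD y z : N y -> N z -> N (y + z).
    move=> /mem_set Ny /mem_set Nz; apply/set_mem.
    (* [GRing.zmod_closed] speaks of differences, so [y + z] is read as [y - (0 - z)]. *)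
    by rewrite -[z]opprK -(sub0r z); apply: (NB) => //; apply: NB.
  rewrite (fsbigTE (fset_set (c @^-1` [set~ 0]))).
    by apply: big_ind => // i _; case: (NAc i).
  by move=> i; rewrite in_fset_set // notin_setE /= => /contrapT.
- by move=> x c d /(decomposition_sub NAA) cx /(decomposition_sub NAA); apply: uniqA.
Qed.

Lemma submod_closed_zmod (R : comNzRingType) (M : lmodType R) (N : set M) :
  GRing.submod_closed (mem N) -> GRing.zmod_closed (mem N).
Proof.
move=> [N0 NL]; split=> // x y Nx Ny.
by rewrite addrC -scaleN1r; apply: NL.
Qed.

Lemma graded_submodule_component (G : groupType) (R : comNzRingType)
    (M : lmodType R) (Mg : G -> set M) (N : set M) :
  direct_sum [set: M] Mg -> GRing.submod_closed (mem N) ->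
  (forall x c, N x -> decomposition Mg x c -> forall g, N (c g)) ->
  graded_submodule Mg N.
Proof.
move=> sumM closedN Ncomp; split=> //.
by apply: direct_sum_setI => //; apply: submod_closed_zmod.
Qed.

Section GradedHom.
Variables (G : groupType) (R : comNzRingType) (M T : lmodType R).
Variables (Mg : G -> set M) (Tg : G -> set T) (f : {linear M -> T}).
Hypotheses (sumM : direct_sum [set: M] Mg) (sumT : direct_sum [set: T] Tg).
Hypothesis hf : graded_hom Mg Tg f.

Lemma graded_submodule_preimage (K : set T) :
  graded_submodule Tg K -> graded_submodule Mg (f @^-1` K).
Proof.
move=> [[K0 KL] sumK]; apply: graded_submodule_component => //.
  split; first by rewrite inE /= raddf0 -in_setE.
  move=> a x y; rewrite !inE /= linearP => /mem_set Kx /mem_set Ky.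
  exact/set_mem/KL.
(* The components of [f x] are the [f (c g)], and they lie in [K] because [K] is graded. *)
move=> x c Kfx /(decomposition_additive hf) fcx g.
exact: (direct_sum_component g sumT sumK Kfx fcx).
Qed.

Lemma graded_submodule_image (N : set M) :
  graded_submodule Mg N -> graded_submodule Tg (f @` N).
Proof.
move=> [[N0 NL] sumN]; apply: graded_submodule_component => //.
  split; first by apply/mem_set; exists 0; [apply/set_mem|rewrite raddf0].
  move=> a _ _ /set_mem[x /mem_set Nx <-] /set_mem[y /mem_set Ny <-].
  by apply/mem_set; exists (a *: x + y); [apply/set_mem/NL|rewrite linearP].
move=> _ d [x Nx <-] dfx g; have [c cx] := direct_sum_total x sumM.
have [_ _ uniqT] := sumT.
(* By uniqueness in [T], the given [d] is [f \o c], with each [c g] in [N]. *)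
rewrite (uniqT _ _ _ dfx (decomposition_additive hf cx)) /=.
by exists (c g) => //; apply: direct_sum_component sumM sumN Nx cx.
Qed.

(** Any preimage [m] of [t] can be replaced by its component of degree [g]: the images of the
    components of [m] decompose [t], whose only possibly nonzero component is [t] itself, in degree
    [g]. *)
Lemma graded_epi_component (g : G) :
  range f = [set: T] -> Tg g `<=` f @` Mg g.
Proof.
move=> surjf t Tgt; have : [set: T] t by [].
rewrite -surjf => -[m _ fm]; have [c cm] := direct_sum_total m sumM.
have fct : decomposition Tg t (f \o c)
  by rewrite -fm; exact (decomposition_additive hf cm).
have [_ _ uniqT] := sumT; have [_ Mc _] := cm.
have T0 h : Tg h 0 by apply: direct_sum0 sumT.
have /(congr1 (@^~ g)) := uniqT _ _ _ fct (decomposition_delta T0 Tgt).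
by rewrite /= eqxx => fcg; exists (c g).
Qed.

End GradedHom.

(** If [f m = f n] with [n] in [N], then [m - n] lies in the kernel, hence in [N], and
    [m = (m - n) + n]. *)
Lemma ker_sub_image (R : comNzRingType) (M T : lmodType R)
    (f : {linear M -> T}) (N : set M) (m : M) :
  GRing.submod_closed (mem N) -> ker f `<=` N -> (f @` N) (f m) -> N m.
Proof.
move=> [_ NL] kerN [n /mem_set Nn fnm].
have /kerN /mem_set Nmn : ker f (m - n) by rewrite /ker /= linearB fnm subrr.
by apply/set_mem; rewrite -(subrK n m) -(scale1r (m - n)); apply: NL.
Qed.

Theorem proposition3p1 (G : groupType) (R : comNzRingType) (M T : lmodType R)
    (Rg : G -> set R) (Mg : G -> set M) (Tg : G -> set T)
    (s : R) (f : {linear M -> T})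
    (gradR : graded_ring Rg)
    (gradM : graded_module Rg Mg)
    (gradT : graded_module Rg Tg)
    (hs : (homogeneous Rg `\ 0) s)
    (hf : graded_hom Mg Tg f) :
  (forall K : set T,
     GSpec Rg Tg s K -> ~ colon (f @^-1` K) s ->
     GSpec Rg Mg s (f @^-1` K)) /\
  (graded_epi Mg Tg f ->
   forall N : set M,
     GSpec Rg Mg s N -> ker f `<=` N ->
     GSpec Rg Tg s (f @` N)).
Proof.
have [sumM _] := gradM; have [sumT _] := gradT; split.
  move=> K [gradK _ primeK] sK; split=> //.
    exact: graded_submodule_preimage gradK.
  move=> r m hr [g _ Mgm]; rewrite /= !linearZ => Krm.
  have hfm : homogeneous Tg (f m) by exists g => //; apply: hf; exists m.
  have [srK|] := primeK _ _ hr hfm Krm; last by right.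
  by left=> x; rewrite /= linearZ; apply: srK.
move=> [_ surjf] N [gradN sN primeN] kerN; have [closedN _] := gradN.
have fN m : (f @` N) (f m) -> N m by apply: ker_sub_image.
split; first exact: graded_submodule_image gradN.
  by move=> sfN; apply: sN => m; apply: fN; rewrite linearZ; apply: sfN.
(* The s-prime condition on [N] only concerns homogeneous elements, so [t] must be lifted to a
   homogeneous [m]. *)
move=> r t hr [g _ /(graded_epi_component sumM sumT hf surjf) [m Mgm <-]].
rewrite -!linearZ => /fN Nrm; have hm : homogeneous Mg m by exists g.
have [srN|Nsm] := primeN _ _ hr hm Nrm; last by right; exists (s *: m).
(* Surjectivity carries [srN] from [M] to all of [T]. *)
left=> u; have : [set: T] u by [].
by rewrite -surjf => -[x _ <-]; exists (s * r *: x) => //; rewrite linearZ.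
Qed.
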